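(* Let $R=\mathbb{C}[x_1,\ldots,x_n]$ and let $I=\langle f_1,\ldots,f_s\rangle\subset R$ be an ideal with $\dim_{\mathbb{C}} R/I=\delta<\infty$. Let $\mathcal{S}\subset\mathbb{N}^n$ be a finite set, let $V=\bigoplus_{\alpha\in\mathcal{S}}\mathbb{C}\cdot x^\alpha\subset R$, and let $N:V\to\mathbb{C}^\delta$ be a $\mathbb{C}$-linear map with $\ker(N)\subset I\cap V$. Assume that $V$ contains an element $u$ whose class in $R/I$ is invertible. Suppose that there is a vector subspace $W\subset V$ such that $x_i\cdot W\subset V$ for $i=1,\ldots,n$ and such that the restriction $N_{|W}$ has rank $\delta$. Then for any vector subspace $B\subset W$ such that $W=B\oplus\ker(N_{|W})$: (i) $N^*:=N_{|B}:B\to\mathbb{C}^\delta$ is invertible; (ii) there is an isomorphism of $R$-modules $B\simeq R/I$; (iii) $V=B\oplus (V\cap I)$ and $I=(\langle\ker(N)\rangle:u)$; (iv) for $i=1,\ldots,n$, the map $N_i:B\to\mathbb{C}^\delta$, $b\mapsto N(x_i\cdot b)$, decomposes as $N_i=N^*\circ m_{x_i}$, where the maps $m_{x_i}:B\to B$ define the multiplications by $x_i$ in $B$ modulo $I$ and commute, i.e. $m_{x_i}\circ m_{x_j}=m_{x_j}\circ m_{x_i}$ for $1\le i<j\le n$.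
   Context: $\langle\ker(N)\rangle$ is the ideal of $R$ generated by $\ker(N)$. For an ideal $J\subset R$ and $p\in R$, $(J:p)=\{q\in R\mid pq\in J\}$. That $m_{x_i}:B\to B$ is the multiplication by $x_i$ in $B$ modulo $I$ means that $m_{x_i}(b)\in B$ and $m_{x_i}(b)\equiv x_i\cdot b \mod I$ for all $b\in B$. Explicitly, $m_{x_i}(b)=\pi(x_i\cdot b)$, where $\pi:V\to B$ is the projection onto $B$ along $\ker(N)$ (one has $V=B\oplus\ker(N)$). In (ii), the $R$-module structure on $B$ is the one in which $x_i$ acts as $m_{x_i}$. *)

(* Defs.v *)
From HB Require Import structures.
From mathcomp Require Import all_boot all_order all_algebra.
From mathcomp Require Export finmap boolp classical_sets reals complex.
From mathcomp Require Export mpoly.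

Set Implicit Arguments.
Unset Strict Implicit.
Unset Printing Implicit Defensive.

Import GRing.Theory.
Local Open Scope classical_set_scope.
Local Open Scope ring_scope.
Local Open Scope quotient_scope.

Section Ideals.
Variable A : comNzRingType.
Implicit Types (E J : set A) (p q : A).

Definition ideal_gen E : set A :=
  [set p | exists (k : nat) (c e : 'I_k -> A),
     (forall j, E (e j)) /\ p = \sum_(j < k) c j * e j].

Definition colon J p : set A := [set q | J (p * q)].

(* Boolean version of [ideal_gen], as required by [{ideal_quot _}]. *)
Definition ideal_pred E : {pred A} := fun p => `[< ideal_gen E p >].

Lemma ideal_predE E p : (p \in ideal_pred E) = `[< ideal_gen E p >].
Proof. by []. Qed.

Lemma ideal_gen0 E : ideal_gen E 0.
Proof.
exists 0%N, (fun=> 0), (fun=> 0); split; first by case.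
by rewrite big_ord0.
Qed.

Lemma ideal_genD E p q : ideal_gen E p -> ideal_gen E q -> ideal_gen E (p + q).
Proof.
move=> [k [c [e [Ee ->]]]] [l [d [g [Eg ->]]]].
exists (k + l)%N.
exists (fun i => match split i with inl j => c j | inr j => d j end).
exists (fun i => match split i with inl j => e j | inr j => g j end).
split; first by move=> i; case: (split i).
rewrite big_split_ord /=; congr (_ + _); apply: eq_bigr => j _.
  by rewrite -[lshift l j]/(unsplit (inl j)) unsplitK.
by rewrite -[rshift k j]/(unsplit (inr j)) unsplitK.
Qed.

Lemma ideal_genM E p q : ideal_gen E q -> ideal_gen E (p * q).
Proof.
move=> [k [c [e [Ee ->]]]]; exists k, (fun j => p * c j), e; split=> //.
by rewrite mulr_sumr; apply: eq_bigr => j _; rewrite mulrA.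
Qed.

Lemma ideal_pred_zmod_closed E : zmod_closed (ideal_pred E).
Proof.
split=> [|p q]; rewrite !ideal_predE.
  by apply/asboolP/ideal_gen0.
move=> /asboolP Ep /asboolP Eq; apply/asboolP/ideal_genD => //.
by rewrite -mulN1r; apply: ideal_genM.
Qed.

HB.instance Definition _ E :=
  GRing.isZmodClosed.Build A (ideal_pred E) (ideal_pred_zmod_closed E).

(* The library's ring structure on [{ideal_quot _}] is restricted to proper ideals;
   the ring structure is rebuilt here so that the zero ring is allowed. *)
Definition quot_ring E : Type := {ideal_quot (ideal_pred E)}.

Section Quot.
Variable E : set A.
Local Notation Q := (quot_ring E).

HB.instance Definition _ := GRing.Zmodule.on Q.
HB.instance Definition _ := ZmodQuotient.on Q.

Definition quot_cls : A -> Q := \pi_Q.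

Lemma quot_clsP p q : quot_cls p = quot_cls q <-> ideal_gen E (p - q).
Proof.
rewrite /quot_cls; split=> [/eqP|Epq].
  by rewrite -[_ == _]Quotient.idealrBE ideal_predE => /asboolP.
by apply/eqP; rewrite -[_ == _]Quotient.idealrBE ideal_predE; apply/asboolP.
Qed.

Lemma quot_cls_repr (x : Q) : quot_cls (repr x) = x.
Proof. exact: reprK. Qed.

Lemma quot_clsD : {morph quot_cls : p q / p + q}.
Proof. exact: (@pi_addr _ _ _ _ _ Q). Qed.

Definition quot_one : Q := quot_cls 1.
Definition quot_mul (x y : Q) : Q := quot_cls (repr x * repr y).

Lemma quot_clsM p q : quot_mul (quot_cls p) (quot_cls q) = quot_cls (p * q).
Proof.
apply/quot_clsP.
have /quot_clsP Hp := quot_cls_repr (quot_cls p).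
have /quot_clsP Hq := quot_cls_repr (quot_cls q).
set a := repr _ in Hp *; set b := repr _ in Hq *.
have -> : a * b - p * q = b * (a - p) + p * (b - q).
  by rewrite !mulrBr [b * a]mulrC [b * p]mulrC addrA subrK.
by apply: ideal_genD; apply: ideal_genM.
Qed.

Fact quot_mulA : associative quot_mul.
Proof.
move=> x y z; rewrite -[x]quot_cls_repr -[y]quot_cls_repr -[z]quot_cls_repr.
by rewrite !quot_clsM mulrA.
Qed.

Fact quot_mulC : commutative quot_mul.
Proof. by move=> x y; rewrite /quot_mul mulrC. Qed.

Fact quot_mul1 : left_id quot_one quot_mul.
Proof. by move=> x; rewrite -[x]quot_cls_repr quot_clsM mul1r. Qed.

Fact quot_mulDl : left_distributive quot_mul +%R.
Proof.
move=> x y z; rewrite -[x]quot_cls_repr -[y]quot_cls_repr -[z]quot_cls_repr.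
by rewrite !(quot_clsM, =^~ quot_clsD) mulrDl.
Qed.

HB.instance Definition _ := GRing.Zmodule_isComPzRing.Build Q
  quot_mulA quot_mulC quot_mul1 quot_mulDl.

Definition quot_scale (p : A) (x : Q) : Q := quot_cls p * x.

Fact quot_scaleA p q x : quot_scale p (quot_scale q x) = quot_scale (p * q) x.
Proof. by rewrite /quot_scale mulrA; congr (_ * _); exact: quot_clsM. Qed.

Fact quot_scale1 : left_id 1 quot_scale.
Proof. exact: mul1r. Qed.

Fact quot_scaleDr : right_distributive quot_scale +%R.
Proof. by move=> p x y; rewrite /quot_scale mulrDr. Qed.

Fact quot_scaleDl x : {morph quot_scale^~ x : p q / p + q}.
Proof. by move=> p q; rewrite /quot_scale quot_clsD mulrDl. Qed.

HB.instance Definition _ := GRing.Zmodule_isLmodule.Build A Q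
  quot_scaleA quot_scale1 quot_scaleDr quot_scaleDl.

End Quot.

Definition module_action (M : zmodType) (act : A -> M -> M) : Prop :=
  [/\ forall p q x, act p (act q x) = act (p * q) x,
      left_id 1 act,
      right_distributive act +%R &
      forall x, {morph act^~ x : p q / p + q}].

(* A copy of [M] carrying the [A]-module structure given by [act]. *)
Definition action_module (M : zmodType) (act : A -> M -> M)
  (actP : module_action act) : Type := M.

Section ModuleOfAction.
Variables (M : zmodType) (act : A -> M -> M) (actP : module_action act).

Fact action_moduleA p q x : act p (act q x) = act (p * q) x.
Proof. by case: actP. Qed.

Fact action_module1 : left_id 1 act.
Proof. by case: actP. Qed.

Fact action_moduleDr : right_distributive act +%R.
Proof. by case: actP. Qed.

Fact action_moduleDl x : {morph act^~ x : p q / p + q}.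
Proof. by case: actP. Qed.

HB.instance Definition _ := GRing.Zmodule.on (action_module actP).
HB.instance Definition _ :=
  GRing.Zmodule_isLmodule.Build A (action_module actP)
    action_moduleA action_module1 action_moduleDr action_moduleDl.

End ModuleOfAction.

End Ideals.

Section PolySpan.
Variables (F : fieldType) (n : nat).

Section Type_.
Variable S : {fset 'X_{1..n}}.

Definition in_polyspan : {pred {mpoly F[n]}} :=
  fun p => all (fun a => a \in S) (msupp p).

Lemma in_polyspanP (p : {mpoly F[n]}) :
  reflect {subset msupp p <= S} (p \in in_polyspan).
Proof. exact: allP. Qed.

Lemma in_polyspan_submod_closed : submod_closed in_polyspan.
Proof.
split; first by apply/in_polyspanP => a; rewrite msupp0.
move=> c p q /in_polyspanP Sp /in_polyspanP Sq; apply/in_polyspanP => a.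
by move/msuppD_le; rewrite mem_cat => /orP[/msuppZ_le/Sp|/Sq].
Qed.

HB.instance Definition _ :=
  GRing.isSubmodClosed.Build F {mpoly F[n]} in_polyspan
    in_polyspan_submod_closed.

Record polyspan :=
  PolySpan { polyspan_val :> {mpoly F[n]}; _ : polyspan_val \in in_polyspan }.

HB.instance Definition _ := [isSub for polyspan_val].
HB.instance Definition _ := [Choice of polyspan by <:].
HB.instance Definition _ := [SubChoice_isSubLmodule of polyspan by <:].

Lemma polyspan_vecaxiom : vector_axiom #|` S| polyspan.
Proof.
pose M (i : 'I_(#|` S|)) := nth 0%MM S i.
exists (fun p : polyspan => \row_i (val p)@_(M i)) => [c p q|].
  by apply/matrixP=> i j; rewrite !mxE /= mcoeffD mcoeffZ.
pose g (r : 'rV[F]_(#|` S|)) : {mpoly F[n]} := \sum_i r 0 i *: 'X_[M i].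
have gS r : g r \in in_polyspan.
  rewrite rpred_sum // => i _; apply/rpredZ/in_polyspanP => a.
  by rewrite msuppX inE => /eqP ->; apply: mem_nth.
have coefg r i : (g r)@_(M i) = r 0 i.
  rewrite /g raddf_sum /= (bigD1 i) //= mcoeffZ mcoeffX eqxx mulr1.
  rewrite big1 ?addr0 // => j ne_ji; rewrite mcoeffZ mcoeffX.
  by rewrite nth_uniq ?fset_uniq // (inj_eq val_inj) (negbTE ne_ji) mulr0.
exists (fun r => PolySpan (gS r)) => [p|r]; last first.
  by apply/matrixP=> i j; rewrite ord1 mxE coefg.
apply/val_inj/mpolyP => a /=; have [aS|aS] := boolP (a \in S).
  have lt_a : (index a S < #|` S|)%N by rewrite index_mem.
  have -> : a = M (Ordinal lt_a) by rewrite /M nth_index.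
  by rewrite coefg mxE.
have notin (q : {mpoly F[n]}) : q \in in_polyspan -> q@_a = 0.
  move=> /in_polyspanP Sq; apply: memN_msupp_eq0.
  by apply: contra aS => /Sq.
by rewrite !notin // (valP p).
Qed.

HB.instance Definition _ := Lmodule_hasFinDim.Build F polyspan
  polyspan_vecaxiom.

(* Equals 0 when ['X_i * v] is not in the span. *)
Definition mulX (i : 'I_n) (v : polyspan) : polyspan :=
  insubd 0 ('X_i * polyspan_val v).

Variables (d : nat) (N : 'Hom(polyspan, 'cV[F]_d)) (B : {vspace polyspan}).

Definition ker_set : set {mpoly F[n]} :=
  [set p | exists2 v, v \in lker N & p = polyspan_val v].

(* [daddv_pi B (lker N)] is the projection onto [B] along [lker N]; it is
   meaningful when [B] and [lker N] are complementary. *)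
Definition multmap (i : 'I_n) (b : subvs_of B) : subvs_of B :=
  vsproj B (daddv_pi B (lker N) (mulX i (vsval b))).

End Type_.

(* The scalars [F] act on [M] through the constant polynomials. *)
Definition has_dim (M : lmodType {mpoly F[n]}) (d : nat) : Prop :=
  exists2 e : M -> 'cV[F]_d, bijective e &
    forall (c : F) x y, e (c%:MP *: x + y) = c *: e x + e y.

End PolySpan.

(* Main.v *)
Require Import Defs.
From HB Require Import structures.
From mathcomp Require Import all_boot all_order all_algebra.

Set Implicit Arguments.
Unset Strict Implicit.
Unset Printing Implicit Defensive.

Import GRing.Theory.
Local Open Scope classical_set_scope.
Local Open Scope complex_scope.
Local Open Scope ring_scope.

(** Everything happens in the class map B -> R/I. The rank condition forces
    dim B = delta and makes B a complement of ker N in V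
    ([rank_complement]); let pi : V -> B be the projection along ker N. For
    b in B the product x_i b still lies in V, and it differs from
    m_i b = pi (x_i b) by an element of ker N, hence of I. So the classes of
    the elements of B form a subspace of R/I stable under every variable, that
    is an ideal ([cls_mul_stable]). It contains the class of pi u, which is the
    class of u and therefore a unit; so it is all of R/I ([cls_surj]). Since
    R/I also has dimension delta, B -> R/I is bijective ([cls_of_bij]).

    The rest is read off this bijection. It turns m_i into multiplication by
    x_i, so the m_i commute, and the module structure of R/I, transported to B,
    lets x_i act as m_i ([transport_module]). Its injectivity says that B meets
    I only in 0, so the decomposition v = pi v + (v - pi v) of v in V along B
    and V :&: I is unique ([direct_sum_ideal]).

    For I = (<ker N> : u) one inclusion is the invertibility of u modulo I.
    For the other, the stability argument above only uses congruences modulo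
    ker N, so it also holds modulo the ideal J = <ker N>: for every q,
    q u is congruent modulo J to some b in B. If q is in I, then b is in I
    because J is contained in I, so b = 0 and q u is in J ([colon_kernel]). *)

(** * The quotient map as a ring morphism *)
Section QuotientMap.
Variables (A : comNzRingType) (E : set A).

Fact quot_cls_is_zmod_morphism : zmod_morphism (quot_cls E).
Proof.
move=> p q; apply/(canRL (addrK _)).
by rewrite -quot_clsD subrK.
Qed.

Fact quot_cls_is_monoid_morphism : monoid_morphism (quot_cls E).
Proof. by split=> // p q; rewrite -quot_clsM. Qed.

HB.instance Definition _ :=
  GRing.isZmodMorphism.Build A (quot_ring E) (quot_cls E)
    quot_cls_is_zmod_morphism.
HB.instance Definition _ :=
  GRing.isMonoidMorphism.Build A (quot_ring E) (quot_cls E)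
    quot_cls_is_monoid_morphism.

Lemma quot_cls_eq0 p : quot_cls E p = 0 <-> ideal_gen E p.
Proof. by rewrite -(rmorph0 (quot_cls E)) quot_clsP subr0. Qed.

Lemma scale_quot_cls p q : p *: quot_cls E q = quot_cls E (p * q).
Proof. by rewrite rmorphM. Qed.

Lemma ideal_gen_incl : E `<=` ideal_gen E.
Proof.
move=> p Ep; exists 1%N, (fun=> 1), (fun=> p); split=> //.
by rewrite big_ord1 mul1r.
Qed.

Lemma ideal_gen_sub (E' : set A) :
  E' `<=` ideal_gen E -> ideal_gen E' `<=` ideal_gen E.
Proof.
move=> sE'E _ [k [c [e [E'e ->]]]]; apply/quot_cls_eq0.
rewrite rmorph_sum big1 //= => j _.
by apply/quot_cls_eq0/ideal_genM/sE'E.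
Qed.

End QuotientMap.

(** * Complements, dimensions and ranks *)

(** [M] is only known through its coordinates [e], so rank-nullity is applied to
    [e \o g], a linear map between spaces of the same dimension. *)
Lemma has_dim_bij (F : fieldType) (n d : nat) (M : lmodType {mpoly F[n]})
    (V : vectType F) (g : V -> M) :
  has_dim M d -> dim V = d ->
  (forall (c : F) x y, g (c *: x + y) = c%:MP *: g x + g y) ->
  (forall z, exists x, g x = z) -> bijective g.
Proof.
move=> [e [e' eK e'K] e_lin] dimV g_lin g_surj.
have h_lin : linear (e \o g) by move=> c x y; rewrite /= g_lin e_lin.
pose hL := GRing.isLinear.Build _ _ _ _ (e \o g) h_lin.
pose h : {linear V -> 'cV[F]_d} := HB.pack (e \o g) hL.
have h_full : limg (linfun h) = fullv.
  apply/vspaceP=> z; rewrite memvf; have [x gx] := g_surj (e' z).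
  by apply/memv_imgP; exists x; rewrite ?memvf // lfunE /= gx e'K.
have /eqP : (\dim (fullv :&: lker (linfun h)) + d)%N = d.
  rewrite -[in RHS]dimV -dimvf -(limg_ker_dim (linfun h) fullv) h_full.
  by rewrite dimvf dim_matrix [(d * 1)%R]muln1.
rewrite capfv -[X in _ == X]add0n eqn_add2r dimv_eq0 => /lker0P h_inj.
have g_inj : injective g.
  by move=> x y gxy; apply: h_inj; rewrite !lfunE /= gxy.
have /choice[g' g'K] := g_surj.
by exists g' => // x; apply: g_inj; rewrite g'K.
Qed.

(** [polyspan_val] is the [val] of the subtype; the instance is attached to the
    projection itself, the form in which it occurs in statements. *)
Fact polyspan_val_is_linear (F : fieldType) n (S : {fset 'X_{1..n}}) :
  linear (@polyspan_val F n S).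
Proof. exact: (linearP (val : polyspan F S -> {mpoly F[n]})). Qed.

HB.instance Definition _ (F : fieldType) n (S : {fset 'X_{1..n}}) :=
  GRing.isLinear.Build F (polyspan F S) {mpoly F[n]} *:%R (@polyspan_val F n S)
    (@polyspan_val_is_linear F n S).

(** [B] is as large as the image of [N] on [W], namely [d], which is also the
    largest possible rank of [N]; so [B] and [lker N] together have dimension
    at least that of [V]. *)
Lemma rank_complement (F : fieldType) (V : vectType F) (d : nat)
    (N : 'Hom(V, 'cV[F]_d)) (W B : {vspace V}) :
  \dim (N @: W) = d -> (B <= W)%VS -> (B + (W :&: lker N))%VS = W ->
  directv (B + (W :&: lker N)) ->
  [/\ \dim B = d, (B :&: lker N = 0)%VS & (B + lker N = fullv)%VS].
Proof.
move=> rkN sBW sumBW /directv_addP capBW.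
have capBN : (B :&: lker N = 0)%VS by rewrite -capBW capvA (capv_idPl sBW).
have dimB : \dim B = d.
  have := limg_ker_dim N W; rewrite rkN -[in RHS]sumBW dimv_disjoint_sum //.
  by rewrite addnC => /addIn.
split=> //; apply/eqP; rewrite eqEdim subvf dimv_disjoint_sum // dimB.
rewrite -(limg_ker_dim N fullv) capfv addnC leq_add2r.
by rewrite (leq_trans (dimvS (subvf _))) // dimvf dim_matrix [(d * 1)%R]muln1.
Qed.

(** * Normal forms in B *)

(** [proj v] is a normal form of [v]. The ideal is generated by an arbitrary set
    [E] whose ideal contains ker N, because the congruences below are used both
    modulo I and modulo the smaller ideal generated by ker N. *)
Section NormalForm.
Variables (F : fieldType) (n : nat) (S : {fset 'X_{1..n}}) (d : nat).
Variables (N : 'Hom(polyspan F S, 'cV[F]_d)) (B : {vspace polyspan F S}).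
Hypothesis capBN : (B :&: lker N = 0)%VS.
Hypothesis sumBN : (B + lker N = fullv)%VS.
Hypothesis mulXB : forall i b, b \in B ->
  'X_i * polyspan_val b \in in_polyspan S.

Let proj := daddv_pi B (lker N).

Lemma subv_proj_ker v : v - proj v \in lker N.
Proof.
rewrite -[X in X - _](daddv_pi_add capBN) ?sumBN ?memvf //.
by rewrite addrAC subrr add0r memv_pi.
Qed.

Lemma map_proj v : N (proj v) = N v.
Proof.
by apply/esym/eqP; rewrite -subr_eq0 -linearB -memv_ker subv_proj_ker.
Qed.

Lemma mulX_val i b : b \in B ->
  polyspan_val (mulX i b) = 'X_i * polyspan_val b.
Proof. by move=> Bb; rewrite [LHS]insubdK // mulXB. Qed.

Lemma vsval_multmap i (b : subvs_of B) :
  vsval (multmap N i b) = proj (mulX i (vsval b)).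
Proof. by rewrite vsprojK // memv_pi. Qed.

Lemma restr_bij : \dim B = d ->
  bijective (fun b : subvs_of B => N (vsval b)).
Proof.
move=> dimB.
have N_inj : injective (fun b : subvs_of B => N (vsval b)).
  move=> x y /= Nxy; apply/val_inj/eqP.
  rewrite -subr_eq0 -memv0 -capBN memv_cap memvB ?subvsP //=.
  by rewrite memv_ker linearB /= subr_eq0; apply/eqP.
have imB : (N @: B)%VS = fullv.
  apply/eqP; rewrite eqEdim subvf (limg_dim_eq capBN) dimB dimvf dim_matrix.
  by rewrite [(d * 1)%R]muln1 leqnn.
have N_surj z : exists b : subvs_of B, N (vsval b) = z.
  have /memv_imgP[b Bb ->] : z \in (N @: B)%VS by rewrite imB memvf.
  by exists (vsproj B b); rewrite vsprojK.
have /choice[g gK] := N_surj.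
by exists g => // x; apply: N_inj; rewrite gK.
Qed.

Lemma map_mulX i (b : subvs_of B) :
  N (mulX i (vsval b)) = N (vsval (multmap N i b)).
Proof. by rewrite vsval_multmap map_proj. Qed.

Variable E : set {mpoly F[n]}.
Hypothesis kerE : ker_set N `<=` ideal_gen E.
Let cls := quot_cls E.

Lemma cls_proj v : cls (polyspan_val (proj v)) = cls (polyspan_val v).
Proof.
apply/esym/quot_clsP/kerE; exists (v - proj v); first exact: subv_proj_ker.
by rewrite raddfB.
Qed.

Lemma cls_multmap i (b : subvs_of B) :
  cls (polyspan_val (vsval (multmap N i b))) =
  cls ('X_i * polyspan_val (vsval b)).
Proof. by rewrite vsval_multmap cls_proj mulX_val // subvsP. Qed.

(** The multipliers [q] that preserve the classes of elements of [B] form a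
    subalgebra; it contains the variables because [x_i b] stays in V and can be
    projected back to [B], so it contains every polynomial. *)
Lemma cls_mul_stable p b : b \in B ->
  exists2 b', b' \in B &
    cls (p * polyspan_val b) = cls (polyspan_val b').
Proof.
pose stable q := forall b, b \in B -> exists2 b', b' \in B &
    cls (q * polyspan_val b) = cls (polyspan_val b').
suff : stable p by apply.
have stable1 : stable 1 by move=> c Bc; exists c; rewrite // mul1r.
have stableM q r : stable q -> stable r -> stable (q * r).
  move=> stq str c /str[c1 /stq[c2 Bc2 Eqc] Erc]; exists c2 => //.
  by rewrite -mulrA [LHS]rmorphM [X in _ * X]Erc -Eqc [RHS]rmorphM.
have stableX i : stable 'X_i.
  move=> c Bc; exists (proj (mulX i c)); first exact: memv_pi.
  by rewrite cls_proj mulX_val.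
elim/mpolyind: p => [|a m p _ _ stp] c Bc.
  by exists 0; rewrite ?mem0v // mul0r raddf0.
have [c1 Bc1 Epc] := stp _ Bc.
have [c2 Bc2 Emc] : exists2 b', b' \in B &
    cls ('X_[m] * polyspan_val c) = cls (polyspan_val b').
  rewrite mpolyXE_id; apply: (big_ind stable) => // i _.
  by elim: (m i) => [|k IHk]; rewrite ?expr0 ?exprS //; apply: stableM.
exists (a *: c2 + c1); first by rewrite memvD ?memvZ.
rewrite linearP /= mulrDl -scalerAl -!mul_mpolyC [LHS]rmorphD [RHS]rmorphD.
by congr (_ + _); rewrite // [LHS]rmorphM [X in _ * X]Emc [RHS]rmorphM.
Qed.

(** The classes of [B] form an ideal of the quotient that contains the unit
    [cls u], hence everything: [x = (x * y) * cls u]. *)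
Lemma cls_surj (u : polyspan F S) : (exists y, cls (polyspan_val u) * y = 1) ->
  forall x, exists2 b, b \in B & x = cls (polyspan_val b).
Proof.
move=> [y uy1] x.
have [b Bb Eb] :=
  cls_mul_stable (repr x * repr y) (memv_pi B (lker N) u).
exists b => //; rewrite -Eb [RHS]rmorphM [X in _ * X]cls_proj /= rmorphM /=.
by rewrite !quot_cls_repr -mulrA [y * _]mulrC uy1 mulr1.
Qed.


(** * The isomorphism between B and the quotient *)
Definition cls_of (b : subvs_of B) : quot_ring E :=
  cls (polyspan_val (vsval b)).

Lemma cls_of_linear c x y :
  cls_of (c *: x + y) = c%:MP *: cls_of x + cls_of y.
Proof.
rewrite /cls_of [vsval _]linearP [polyspan_val _]linearP /= -mul_mpolyC.
by rewrite [LHS]rmorphD scale_quot_cls.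
Qed.

Lemma cls_of_multmap i b : cls_of (multmap N i b) = 'X_i *: cls_of b.
Proof. by rewrite /cls_of cls_multmap scale_quot_cls. Qed.

Lemma cls_of_bij (u : polyspan F S) :
  (exists y, cls (polyspan_val u) * y = 1) -> \dim B = d ->
  has_dim (quot_ring E) d -> bijective cls_of.
Proof.
move=> u_unit dimB dimQ.
apply: (has_dim_bij dimQ) cls_of_linear _ => [|z]; first by rewrite -dimB.
have [b Bb ->] := cls_surj u_unit z.
by exists (vsproj B b); rewrite /cls_of vsprojK.
Qed.

Hypothesis cls_bij : bijective cls_of.

Lemma multmapC i j (b : subvs_of B) :
  multmap N i (multmap N j b) = multmap N j (multmap N i b).
Proof.
apply: (bij_inj cls_bij).
by rewrite !cls_of_multmap !scalerA mulrC.
Qed.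

(** The action is that of the quotient pulled back along [cls_of]; the action
    axioms, and the values on constants and variables, are checked after
    applying the injective [cls_of]. *)
Lemma transport_module :
  exists (act : {mpoly F[n]} -> subvs_of B -> subvs_of B)
         (actP : module_action act),
    [/\ forall c b, act c%:MP b = c *: b,
        forall i b, act 'X_i b = multmap N i b &
        exists phi : {linear action_module actP -> quot_ring E},
          bijective phi].
Proof.
have cls_inj := bij_inj cls_bij.
case: (cls_bij) => g _ gK.
have clsD : {morph cls_of : x y / x + y}.
  move=> x y; have := cls_of_linear 1 x y.
  by rewrite scale1r mpolyC1 scale1r.
pose act p b := g (p *: cls_of b).
have cls_act p b : cls_of (act p b) = p *: cls_of b by rewrite gK.
have actP : module_action act.
  split=> [p q x|x|p x y|x p q]; apply: cls_inj.
  + by rewrite !cls_act scalerA.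
  + by rewrite cls_act scale1r.
  + by rewrite clsD !cls_act clsD scalerDr.
  + by rewrite clsD !cls_act scalerDl.
exists act, actP; split=> [c b|i b|].
- apply: cls_inj; have := cls_of_linear c b 0.
  have -> : cls_of 0 = 0 by apply: (addIr (cls_of 0)); rewrite -clsD !add0r.
  by rewrite !addr0 cls_act.
- by apply: cls_inj; rewrite cls_act cls_of_multmap.
have cls_lin : linear (cls_of : action_module actP -> quot_ring E).
  by move=> p x y; rewrite clsD -cls_act.
pose clsL := GRing.isLinear.Build _ _ _ _
  (cls_of : action_module actP -> quot_ring E) cls_lin.
pose phi : {linear action_module actP -> quot_ring E} :=
  HB.pack (cls_of : action_module actP -> quot_ring E) clsL.
by exists phi.
Qed.

Lemma ideal_meets_B b :
  b \in B -> ideal_gen E (polyspan_val b) -> b = 0.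
Proof.
move=> Bb Eb; rewrite -(vsprojK Bb) (_ : vsproj B b = 0) ?linear0 //.
apply: (bij_inj cls_bij); rewrite /cls_of vsprojK // !linear0 [RHS]raddf0.
exact/quot_cls_eq0.
Qed.

(** Two decompositions of [v] have first components that are congruent modulo
    the ideal, and [B] meets the ideal trivially. *)
Lemma direct_sum_ideal v :
  exists! bw : polyspan F S * polyspan F S,
    [/\ bw.1 \in B, ideal_gen E (polyspan_val bw.2) & v = bw.1 + bw.2].
Proof.
exists (proj v, v - proj v); split=> /= [|[b w] [/= Bb Ew Dv]].
  split; [exact: memv_pi | | by rewrite addrC subrK].
  by apply: kerE; eexists; first exact: subv_proj_ker.
suff <- : b = proj v by rewrite Dv addrAC subrr add0r.
apply/eqP; rewrite -subr_eq0; apply/eqP/ideal_meets_B.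
  by rewrite memvB ?memv_pi.
rewrite raddfB; apply/quot_clsP; rewrite [RHS]cls_proj.
by apply/esym/quot_clsP; rewrite -raddfB Dv addrAC subrr add0r.
Qed.

End NormalForm.

(** * The ideal as a colon ideal *)

(** If [q] lies in the ideal, reduce [u * q] modulo the ideal of ker N to an
    element [b] of [B]: the same congruence modulo the larger ideal shows that
    [b] lies in it, so [b = 0]. *)
Lemma colon_kernel (F : fieldType) (n : nat) (S : {fset 'X_{1..n}}) (d : nat)
    (N : 'Hom(polyspan F S, 'cV[F]_d)) (B : {vspace polyspan F S})
    (E : set {mpoly F[n]}) (u : polyspan F S) :
  (B :&: lker N = 0)%VS -> (B + lker N = fullv)%VS ->
  (forall i b, b \in B -> 'X_i * polyspan_val b \in in_polyspan S) ->
  ker_set N `<=` ideal_gen E -> bijective (@cls_of _ _ _ B E) ->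
  (exists y, quot_cls E (polyspan_val u) * y = 1) ->
  ideal_gen E = colon (ideal_gen (ker_set N)) (polyspan_val u).
Proof.
move=> capBN sumBN mulXB kerE cls_bij [y uy1].
apply/seteqP; split=> q; last first.
  rewrite /colon /= => /(ideal_gen_sub kerE)/quot_cls_eq0.
  rewrite rmorphM /= => uq0; apply/quot_cls_eq0.
  by rewrite -[LHS]mul1r -uy1 mulrAC uq0 mul0r.
move=> Eq; rewrite /colon /=; set J := ker_set N.
have kerJ := @ideal_gen_incl _ J.
have [b Bb Eb] :=
  cls_mul_stable capBN sumBN mulXB kerJ q (memv_pi B (lker N) u).
have Euq : quot_cls J (polyspan_val u * q) = quot_cls J (polyspan_val b).
  by rewrite -Eb mulrC !rmorphM /= (cls_proj capBN sumBN kerJ).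
apply/quot_cls_eq0; rewrite Euq (ideal_meets_B cls_bij Bb) ?raddf0 //.
move/quot_clsP/(ideal_gen_sub kerE)/quot_clsP: Euq => Euq.
by apply/quot_cls_eq0; rewrite -Euq; apply/quot_cls_eq0/ideal_genM.
Qed.

Theorem theorem3p1 (K : realType) (n s delta : nat)
    (f : 'I_s -> {mpoly K[i][n]}) (S : {fset 'X_{1..n}})
    (N : 'Hom(polyspan K[i] S, 'cV[K[i]]_delta))
    (u : polyspan K[i] S) (W : {vspace polyspan K[i] S}) :
  let I := ideal_gen (range f) in
  has_dim (quot_ring (range f)) delta ->
  ker_set N `<=` I ->
  (exists y : quot_ring (range f),
     quot_cls (range f) (polyspan_val u) * y = 1) ->
  (forall (i : 'I_n) (w : polyspan K[i] S), w \in W ->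
     'X_i * polyspan_val w \in in_polyspan S) ->
  \dim (N @: W)%VS = delta ->
  forall B : {vspace polyspan K[i] S},
  (B <= W)%VS ->
  (B + (W :&: lker N))%VS = W ->
  directv (B + (W :&: lker N)) ->
  let Nstar := fun b : subvs_of B => N (vsval b) in
  let m := multmap N (B := B) in
  [/\ bijective Nstar,
      exists (act : {mpoly K[i][n]} -> subvs_of B -> subvs_of B)
             (actP : module_action act),
        [/\ forall c b, act c%:MP b = c *: b,
            forall i b, act 'X_i b = m i b &
            exists phi : {linear action_module actP -> quot_ring (range f)},
              bijective phi],
      (forall v : polyspan K[i] S,
         exists! bw : polyspan K[i] S * polyspan K[i] S,
           [/\ bw.1 \in B, I (polyspan_val bw.2) & v = bw.1 + bw.2])
      /\ I = colon (ideal_gen (ker_set N)) (polyspan_val u) &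
      [/\ forall i b, N (mulX i (vsval b)) = Nstar (m i b),
          forall i b, I (polyspan_val (vsval (m i b))
                         - 'X_i * polyspan_val (vsval b)) &
          forall i j : 'I_n, (i < j)%N -> m i \o m j =1 m j \o m i]].
Proof.
move=> I dimQ kerI u_unit mulXW rkN B sBW sumBW dirBW Nstar m.
have [dimB capBN sumBN] := rank_complement rkN sBW sumBW dirBW.
have mulXB i b : b \in B -> 'X_i * polyspan_val b \in in_polyspan S.
  by move=> Bb; apply: mulXW; apply: (subvP sBW).
have cls_bij := cls_of_bij capBN sumBN mulXB kerI u_unit dimB dimQ.
split.
- exact: restr_bij.
- exact: (transport_module capBN sumBN mulXB kerI cls_bij).
- split; first exact: (direct_sum_ideal capBN sumBN kerI cls_bij).
  exact: (colon_kernel capBN sumBN mulXB kerI cls_bij u_unit).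
split=> [i b|i b|i j _ b].
- exact: (map_mulX capBN sumBN).
- by apply/quot_clsP; apply: (cls_multmap capBN sumBN mulXB kerI).
exact: (multmapC capBN sumBN mulXB kerI cls_bij).
Qed.
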